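(* Suppose that $N$ ordinal categories $[N]=\{1,\ldots,N\}$ have corresponding positive climatological probabilities $(p_1,\ldots,p_N)$ and cumulative probability vector $\mathbf{P}=(P_1,\ldots,P_N)$, $P_k=\sum_{i=1}^k p_i$. Define $\mathbf{w}=(w_1,\ldots,w_{N-1})$ by $w_k=((N-1)P_k(1-P_k))^{-1}$ for $1\le k\le N-1$. (i) The SEEPS score equals $\mathrm{GDS}_{\mathrm c}(\cdot,\cdot\,;\mathbf{P},\mathbf{w})$ when $N=3$. (ii) The positively oriented Gerrity score for $3$ ordinal categories with corresponding climatological probabilities $(p_1,p_2,p_3)$ is equivalent to the negatively oriented SEEPS score with the same categorical climatological probabilities. (iii) The positively oriented Gerrity score for $N$ ordinal categories $[N]$ is equivalent to the negatively oriented scoring function $\mathrm{GDS}_{\mathrm c}(\cdot,\cdot\,;\mathbf{P},\mathbf{w})$. (iv) The equitability constant of $\mathrm{GDS}_{\mathrm c}(\cdot,\cdot\,;\mathbf{P},\mathbf{w})$ is $1$.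
   Context: The climatological probabilities sum to $1$. A categorical score is given by a scoring matrix whose $(i,j)$ entry is the score when category $i$ is forecast and category $j$ is observed. ''Positively oriented'' means larger is better, ''negatively oriented'' means smaller is better. For nonnegative weights $\mathbf{w}=(w_1,\ldots,w_{N-1})$, $\mathrm{GDS}_{\mathrm c}(\cdot,\cdot\,;\mathbf{P},\mathbf{w}):[N]\times[N]\to[0,\infty)$ is $$\mathrm{GDS}_{\mathrm c}(i,j;\mathbf{P},\mathbf{w})=\sum_{k=1}^{N-1}w_kS_{P_k,k}(i,j),$$ where $S_{\alpha,\theta}(x,y)$ equals $\alpha$ if $x\le\theta<y$, $1-\alpha$ if $x>\theta\ge y$, and $0$ otherwise. Equivalently its matrix entries are $0$ if $i=j$, $\sum_{k=i}^{j-1}w_kP_k$ if $i<j$, and $\sum_{k=j}^{i-1}w_k(1-P_k)$ if $j<i$. The SEEPS score with climatological probabilities $(p_1,p_2,p_3)$ has scoring matrix $$\frac12\begin{pmatrix}0&\frac1{1-p_1}&\frac1{p_3}+\frac1{1-p_1}\\ \frac1{p_1}&0&\frac1{p_3}\\ \frac1{p_1}+\frac1{1-p_3}&\frac1{1-p_3}&0\end{pmatrix}.$$ The Gerrity score for $N$ ordinal categories has scoring matrix $(g_{i,j})$ given by $$g_{i,i}=\frac1{N-1}\Bigl(\sum_{k=1}^{i-1}R(k)+\sum_{k=i}^{N-1}D(k)\Bigr)\quad(1\le i\le N),$$ $$g_{i,j}=\frac1{N-1}\Bigl(\sum_{k=1}^{i-1}R(k)+\sum_{k=i}^{j-1}(-1)+\sum_{k=j}^{N-1}D(k)\Bigr)\quad(1\le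 i<j\le N),$$ $g_{i,j}=g_{j,i}$ for $j<i$, where $D(k)=(1-P_k)/P_k$ and $R(k)=1/D(k)$ for $1\le k\le N-1$. For $N=3$ this is the matrix $$\frac12\begin{pmatrix}\frac{1-p_1}{p_1}+\frac{p_3}{1-p_3}&\frac{p_3}{1-p_3}-1&-2\\ \frac{p_3}{1-p_3}-1&\frac{p_1}{1-p_1}+\frac{p_3}{1-p_3}&\frac{p_1}{1-p_1}-1\\ -2&\frac{p_1}{1-p_1}-1&\frac{p_1}{1-p_1}+\frac{1-p_3}{p_3}\end{pmatrix}.$$ A scoring function $S'$ on $\mathcal{F}\times\mathcal{O}$ is equivalent to $S$ if there exist a nonzero constant $a$ and $h:\mathcal{O}\to\mathbb{R}$ with $S'(x,y)=aS(x,y)+h(y)$ for all $x,y$. The equitability constant of $S:[N]\times[N]\to\mathbb{R}$ with respect to $(p_1,\ldots,p_N)$ is the constant $c$ such that $\sum_{j=1}^N p_jS(i,j)=c$ for every $i\in[N]$. *)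

(* Defs.v *)
From mathcomp Require Import all_boot all_order all_algebra.

Set Implicit Arguments.
Unset Strict Implicit.
Unset Printing Implicit Defensive.

Import Order.TTheory GRing.Theory Num.Theory.
Local Open Scope ring_scope.

(* Categories 1, ..., N are the elements of 'I_N; [label i] is the 1-based
   number of the category.  Families indexed by thresholds k = 1, ..., N - 1
   (P, w, D) are functions on nat keeping the 1-based indices of the formulas;
   no formula reads them outside of 1 <= k <= N - 1. *)
Definition label (N : nat) (i : 'I_N) : nat := i.+1.

Definition climatology (R : realFieldType) (N : nat) (p : 'I_N -> R) : Prop :=
  (forall i, 0 < p i) /\ \sum_(i < N) p i = 1.

Definition cumprob (R : realFieldType) (N : nat) (p : 'I_N -> R) (k : nat) : R :=
  \sum_(i < N | (label i <= k)%N) p i.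

(* S_{alpha,theta}(x, y): x is the forecast, y the observation. *)
Definition elementary_score (R : realFieldType) (d : Order.disp_t)
    (T : orderType d) (alpha : R) (theta x y : T) : R :=
  if (x <= theta < y)%O then alpha
  else if (y <= theta < x)%O then 1 - alpha
  else 0.

Definition GDSc (R : realFieldType) (N : nat) (P w : nat -> R) : 'M[R]_N :=
  \matrix_(i < N, j < N)
    \sum_(1 <= k < N) w k * elementary_score (P k) k (label i) (label j).

Definition gds_weight (R : realFieldType) (N : nat) (p : 'I_N -> R) (k : nat) : R :=
  (N.-1%:R * cumprob p k * (1 - cumprob p k))^-1.

Definition seeps (R : realFieldType) (p : 'I_3 -> R) : 'M[R]_3 :=
  let p1 := p ord0 in
  let p3 := p ord_max in
  2^-1 *: \matrix_(i < 3, j < 3)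
    nth 0 (nth [::]
      [:: [:: 0;                        (1 - p1)^-1;  p3^-1 + (1 - p1)^-1];
          [:: p1^-1;                    0;            p3^-1              ];
          [:: p1^-1 + (1 - p3)^-1;      (1 - p3)^-1;  0                  ]]
      i) j.

Section Gerrity.
Variables (R : realFieldType) (N : nat) (p : 'I_N -> R).

Definition gerrity_D (k : nat) : R := (1 - cumprob p k) / cumprob p k.

Definition gerrity_R (k : nat) : R := (gerrity_D k)^-1.

Definition gerrity_diag (a : nat) : R :=
  N.-1%:R^-1 * (\sum_(1 <= k < a) gerrity_R k + \sum_(a <= k < N) gerrity_D k).

Definition gerrity_upper (a b : nat) : R :=
  N.-1%:R^-1 * (\sum_(1 <= k < a) gerrity_R k + \sum_(a <= k < b) (-1)
                + \sum_(b <= k < N) gerrity_D k).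

Definition gerrity : 'M[R]_N :=
  \matrix_(i < N, j < N)
    if i == j then gerrity_diag (label i)
    else if (i < j)%N then gerrity_upper (label i) (label j)
    else gerrity_upper (label j) (label i).

End Gerrity.

Definition score_equivalent (R : realFieldType) (F O : Type)
    (S' S : F -> O -> R) : Prop :=
  exists (a : R) (h : O -> R),
    a != 0 /\ forall x y, S' x y = a * S x y + h y.

Definition equitability_constant (R : realFieldType) (N : nat) (p : 'I_N -> R)
    (S : 'I_N -> 'I_N -> R) (c : R) : Prop :=
  forall i : 'I_N, \sum_(j < N) p j * S i j = c.

(* Main.v *)
Require Import Defs.
From mathcomp Require Import all_boot all_order all_algebra.
From mathcomp Require Import ring.

Set Implicit Arguments.
Unset Strict Implicit.
Unset Printing Implicit Defensive.

Import Order.TTheory GRing.Theory Num.Theory.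
Local Open Scope ring_scope.

(** All the scores involved are sums over the thresholds [1 <= k < N], and
    everything is checked threshold by threshold.

    Write [a] and [b] for the labels of the forecast and of the observation.
    The contribution of [k] to [(N - 1)] times the Gerrity score is [R k] if
    [k] is smaller than both labels, [D k] if it is at least as large as both,
    and [-1] otherwise ([gerrity_upperE]).  The weight [w_k] is such that
    [(N - 1) * w_k * S] is [1 / (1 - P_k) = 1 + R k] if [a <= k < b],
    [1 / P_k = 1 + D k] if [b <= k < a], and [0] otherwise.  The two
    contributions thus add up to [R k] if [k < b] and to [D k] if [b <= k],
    which does not depend on [a]: the Gerrity score is the negative of GDSc plus
    the diagonal Gerrity entry of the observation ([gerrity_GDSc]).

    For equitability, the expectation over the observations of the elementary
    score at [k] is [P_k * (1 - P_k)] whatever the forecast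
    ([expected_elementary_score]), so every threshold contributes
    [1 / (N - 1)].

    For three categories, [P_1 = p_1] and [P_2 = 1 - p_3], and GDSc is the SEEPS
    matrix entry by entry; the equivalence of the Gerrity and SEEPS scores is
    then the case [N = 3] of the general one. *)

Section Climatology.
Variables (R : realFieldType) (N : nat) (p : 'I_N -> R).
Hypothesis p_clim : climatology p.

(** Since the probabilities sum to [1], the complement of [P_k] is the
    probability that the observation lies above the threshold [k]. *)
Lemma cumprobC (k : nat) :
  1 - cumprob p k = \sum_(i < N | (k < label i)%N) p i.
Proof.
apply/eqP; rewrite subr_eq eq_sym addrC -p_clim.2.
rewrite [eqbRHS](bigID (fun i : 'I_N => (label i <= k)%N)) /=; apply/eqP.
by congr (_ + _); apply: eq_bigl => i; rewrite ltnNge.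
Qed.

Lemma sum_climatology_gt0 (A : pred 'I_N) (i : 'I_N) :
  A i -> 0 < \sum_(j < N | A j) p j.
Proof.
move=> Ai; rewrite (bigD1 i) //= ltr_wpDr ?p_clim.1 //.
by apply: sumr_ge0 => j _; apply/ltW/p_clim.1.
Qed.

Lemma cumprob_gt0 (k : nat) : (0 < k < N)%N -> 0 < cumprob p k.
Proof.
case/andP=> k_gt0 ltkN.
by apply: (sum_climatology_gt0 (i := Ordinal (ltn_trans k_gt0 ltkN))).
Qed.

Lemma cumprobC_gt0 (k : nat) : (k < N)%N -> 0 < 1 - cumprob p k.
Proof.
by move=> ltkN; rewrite cumprobC (sum_climatology_gt0 (i := Ordinal ltkN)) /label.
Qed.

(** A forecast at or below [k] is charged [P_k] when the observation is above
    [k], which has probability [1 - P_k]; for a forecast above [k] the two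
    factors are exchanged. *)
Lemma expected_elementary_score (k a : nat) :
  \sum_(j < N) p j * elementary_score (cumprob p k) k a (label j)
    = cumprob p k * (1 - cumprob p k).
Proof.
rewrite /elementary_score leEnat ltEnat /=.
have [leak | ltka] := leqP a k.
  rewrite cumprobC mulr_sumr [RHS]big_mkcond; apply: eq_bigr => j _ /=.
  by rewrite andbF mulrC; case: ifP => // _; rewrite mul0r.
rewrite [in RHS]mulrC {3}/cumprob mulr_sumr [RHS]big_mkcond.
apply: eq_bigr => j _ /=.
by rewrite andbT mulrC; case: ifP => // _; rewrite mul0r.
Qed.

Lemma GDSc_equitability :
  (1 < N)%N ->
  equitability_constant p (GDSc N (cumprob p) (gds_weight p)) 1.
Proof.
move=> ltN i.
under eq_bigr => j _ do rewrite mxE mulr_sumr.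
rewrite exchange_big /=.
have N1_neq0 : N.-1%:R != 0 :> R by rewrite pnatr_eq0 -lt0n -subn1 subn_gt0.
(* The weight times the expected elementary score is 1 / (N - 1). *)
under eq_big_nat => k /andP[k_gt0 ltkN].
  under eq_bigr => j _ do rewrite mulrCA.
  rewrite -mulr_sumr expected_elementary_score /gds_weight -mulrA invfM mulfVK.
    over.
  by rewrite mulf_neq0 ?lt0r_neq0 ?cumprobC_gt0 ?cumprob_gt0 ?k_gt0.
by rewrite sumr_const_nat subn1 -[LHS]mulr_natr mulVf.
Qed.

(** The three consecutive ranges of thresholds are merged into one sum.  The
    case [a = b] is included, where [gerrity_upper] is the diagonal entry
    ([gerrity_upper_diag]). *)
Lemma gerrity_upperE (a b : nat) :
  (0 < a <= b)%N -> (b <= N)%N ->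
  gerrity_upper p a b = N.-1%:R^-1 * \sum_(1 <= k < N)
    (if (k < a)%N then gerrity_R p k else if (k < b)%N then -1 else gerrity_D p k).
Proof.
case/andP=> a_gt0 leab lebN; rewrite /gerrity_upper; congr (_ * _).
rewrite [RHS](big_cat_nat (n := b)) ?(leq_trans a_gt0) //=.
rewrite [X in _ = X + _](big_cat_nat (n := a)) //=.
congr (_ + _ + _); apply: eq_big_nat => k /andP[lek ltk].
- by rewrite ltk.
- by rewrite ltk ltnNge lek.
- by rewrite !ltnNge (leq_trans leab) // lek.
Qed.

Lemma gerrity_upper_diag (a : nat) : gerrity_upper p a a = gerrity_diag p a.
Proof. by rewrite /gerrity_upper [X in _ + X + _]big_geq // addr0. Qed.

Lemma gerrity_entryE (i j : 'I_N) :
  gerrity p i j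
    = gerrity_upper p (minn (label i) (label j)) (maxn (label i) (label j)).
Proof.
rewrite mxE /minn /maxn /label ltnS; case: eqP => [-> | _].
  by rewrite ltnn gerrity_upper_diag.
by case: ifP.
Qed.

(** As GDSc vanishes on the diagonal, the observation-dependent shift between
    the two scores can only be the diagonal of the Gerrity matrix. *)
Lemma gerrity_GDSc (i j : 'I_N) :
  gerrity p i j
    = -1 * GDSc N (cumprob p) (gds_weight p) i j + gerrity_diag p (label j).
Proof.
rewrite gerrity_entryE -gerrity_upper_diag !gerrity_upperE ?leqnn //; last 3 first.
- exact: ltn_ord.
- by rewrite leq_min /label /= geq_min leq_max leqnn.
- by rewrite geq_max /label !ltn_ord.
rewrite mxE mulN1r [RHS]addrC -sumrN !mulr_sumr -big_split /=.
apply: eq_big_nat => k kN; have ltkN : (k < N)%N by case/andP: kN.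
have N1_neq0 : N.-1%:R != 0 :> R.
  case/andP: kN => k_gt0 _.
  by rewrite pnatr_eq0 -lt0n -subn1 subn_gt0 (leq_trans _ ltkN).
have P_neq0 := lt0r_neq0 (cumprob_gt0 kN).
have PC_neq0 := lt0r_neq0 (cumprobC_gt0 ltkN).
rewrite /elementary_score leEnat ltEnat /= leq_min leq_max.
rewrite /gds_weight /gerrity_R /gerrity_D.
case: (ltnP k (label i)) => _; case: (ltnP k (label j)) => _ /=;
  by field; rewrite ?N1_neq0 ?P_neq0 ?PC_neq0.
Qed.

Lemma gerrity_equiv_GDSc :
  score_equivalent (gerrity p) (GDSc N (cumprob p) (gds_weight p)).
Proof.
exists (-1), (fun j => gerrity_diag p (label j)).
by split; [rewrite oppr_eq0 oner_eq0 | exact: gerrity_GDSc].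
Qed.

End Climatology.

Lemma seeps_GDSc (R : realFieldType) (p : 'I_3 -> R) :
  climatology p -> seeps p = GDSc 3 (cumprob p) (gds_weight p).
Proof.
move=> p_clim.
have P1E : cumprob p 1 = p ord0.
  by rewrite /cumprob big_mkcond !big_ord_recl big_ord0 /= !addr0.
have PC2E : 1 - cumprob p 2 = p ord_max.
  by rewrite cumprobC // big_mkcond !big_ord_recr big_ord0 /= !add0r.
have P2E : cumprob p 2 = 1 - p ord_max by rewrite -PC2E; ring.
have P1_neq0 := lt0r_neq0 (@cumprob_gt0 _ _ _ p_clim 1 isT).
have P2_neq0 := lt0r_neq0 (@cumprob_gt0 _ _ _ p_clim 2 isT).
have PC1_neq0 := lt0r_neq0 (@cumprobC_gt0 _ _ _ p_clim 1 isT).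
have PC2_neq0 := lt0r_neq0 (@cumprobC_gt0 _ _ _ p_clim 2 isT).
rewrite P1E in P1_neq0 PC1_neq0.
rewrite P2E in P2_neq0.
rewrite PC2E in PC2_neq0.
apply/matrixP => i j; rewrite !mxE big_ltn // big_nat1 /gds_weight P1E P2E.
case: i => [[|[|[|i]]] Hi] //; case: j => [[|[|[|j]]] Hj] //;
  rewrite /elementary_score /label leEnat ltEnat /=; field;
  by rewrite ?subKr ?P1_neq0 ?P2_neq0 ?PC1_neq0 ?PC2_neq0.
Qed.

Theorem proposition4 (R : realFieldType) :
  [/\ forall p : 'I_3 -> R, climatology p ->
        seeps p = GDSc 3 (cumprob p) (gds_weight p),
      forall p : 'I_3 -> R, climatology p ->
        score_equivalent (gerrity p) (seeps p),
      forall (N : nat) (p : 'I_N -> R), (2 <= N)%N -> climatology p ->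
        score_equivalent (gerrity p) (GDSc N (cumprob p) (gds_weight p))
    & forall (N : nat) (p : 'I_N -> R), (2 <= N)%N -> climatology p ->
        equitability_constant p (GDSc N (cumprob p) (gds_weight p)) 1].
Proof.
split=> [p p_clim | p p_clim | N p _ p_clim | N p N_gt1 p_clim].
- exact: seeps_GDSc.
- by rewrite seeps_GDSc //; apply: gerrity_equiv_GDSc.
- exact: gerrity_equiv_GDSc.
- exact: GDSc_equitability.
Qed.
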